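(* Let $k$ be a positive integer. In the game King, the Sprague-Grundy value of the staircase partition $[k,k-1,\ldots,1]$ equals $(k-1)\bmod 3$.
   Context: A partition is a finite weakly decreasing sequence $\lambda=[\lambda_1,\ldots,\lambda_r]$ of positive integers ($[\,]$ is the empty partition). For $i,j\ge 0$, $\lambda[i,j]=[\lambda_{i+1}-j,\lambda_{i+2}-j,\ldots]$ with trailing nonpositive entries removed. King is the impartial game whose positions are nonempty partitions; from $\mu$ a player may move to $\mu[a,b]$ for any $(a,b)\in\{(0,1),(1,0),(1,1)\}$ with $\mu[a,b]\ne[\,]$. The Sprague-Grundy value of a position is the mex (least nonnegative integer not in the set) of the Sprague-Grundy values of the positions reachable in one move (so $0$ for terminal positions). *)

(* Defs.v *)
From HB Require Import structures.
From mathcomp Require Import all_boot zify.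

Set Implicit Arguments.
Unset Strict Implicit.
Unset Printing Implicit Defensive.

Definition is_partition (s : seq nat) : bool :=
  sorted geq s && all (fun p => 0 < p) s.

Record partition := Partition {
  parts :> seq nat;
  _ : is_partition parts
}.
HB.instance Definition _ := [isSub for parts].
HB.instance Definition _ := [Equality of partition by <:].

Lemma partition_sorted (la : partition) : sorted geq la.
Proof. by case: la => s /= /andP[]. Qed.

Lemma partition_gt0 (la : partition) : all (fun p => 0 < p) la.
Proof. by case: la => s /= /andP[]. Qed.

(* Since la is weakly decreasing, the entries that become nonpositive after
   subtracting j are exactly a tail of the list, so filtering out the entries
   p <= j amounts to removing the trailing nonpositive ones; nat subtraction
   is never truncated on the remaining entries. *)
Definition shift_seq (s : seq nat) (i j : nat) : seq nat :=
  [seq p - j | p <- drop i s & j < p].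

Lemma geq_trans : transitive geq.
Proof. by move=> y x z /= yx zy; apply: leq_trans zy yx. Qed.

Lemma shift_seqP (la : partition) i j : is_partition (shift_seq la i j).
Proof.
apply/andP; split; last first.
  by apply/allP => q /mapP[p]; rewrite mem_filter => /andP[jp _] ->; rewrite subn_gt0.
rewrite (homo_sorted (e := geq)) //; first by move=> p q /= ?; apply: leq_sub2r.
apply: (subseq_sorted geq_trans) (partition_sorted la).
exact: subseq_trans (filter_subseq _ _) (drop_subseq _ _).
Qed.

(* la[i, j] *)
Definition shift (la : partition) (i j : nat) : partition :=
  Partition (shift_seqP la i j).

Lemma ex_notin (s : seq nat) : exists n, n \notin s.
Proof.
exists (sumn s).+1; elim: s => //= a s IHs.
suff h n : sumn s < n -> n \notin s by rewrite inE negb_or h; lia.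
elim: {a IHs} s => //= a s IHs lt_n; rewrite inE negb_or IHs; lia.
Qed.

Definition mex (s : seq nat) : nat := ex_minn (ex_notin s).

(* The positions of King are the nonempty partitions; [king_moves la] lists the
   positions reachable from la in one move. *)
Definition king_moves (la : partition) : seq partition :=
  [seq mu <- [:: shift la 0 1; shift la 1 0; shift la 1 1]
         | parts mu != [::]].

(* Every move from a position decreases the sum of the parts, so [sumn la] is
   enough fuel; [grundyE] is the defining recursion. *)
Fixpoint grundy_rec (n : nat) (la : partition) : nat :=
  if n is n'.+1 then mex (map (grundy_rec n') (king_moves la)) else 0.

Definition grundy (la : partition) : nat := grundy_rec (sumn la) la.

Lemma sumn_shift_le (s : seq nat) j : sumn [seq p - j | p <- s & j < p] <= sumn s.
Proof. by elim: s => //= a s IHs; case: ifP => //=; lia. Qed.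

Lemma sumn_king_moves (la mu : partition) :
  mu \in king_moves la -> sumn mu < sumn la.
Proof.
rewrite mem_filter => /andP[mu_n0]; case: la => -[|a s] /= sP.
  by rewrite !inE => /or3P[] /eqP mu_def; rewrite mu_def in mu_n0.
have a_gt0 : 0 < a by case/andP: sP => _ /andP[].
have h j := sumn_shift_le s j.
by rewrite !inE => /or3P[] /eqP ->; rewrite /shift /= /shift_seq /= ?drop0;
  [case: ifP => //= _; have := h 1; lia | have := h 0; lia | have := h 1; lia].
Qed.

Lemma grundy_rec_enough n m (la : partition) :
  sumn la <= n -> sumn la <= m -> grundy_rec n la = grundy_rec m la.
Proof.
have mex0 : mex [::] = 0.
  by rewrite /mex; case: ex_minnP => i _ /(_ 0 isT); case: i.
have moves0 (nu : partition) : sumn nu <= 0 -> king_moves nu = [::].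
  move=> nu0; case E: (king_moves nu) => [//|x l].
  have := @sumn_king_moves nu x; rewrite E mem_head => /(_ isT); lia.
elim: n m la => [|n IHn] [|m] la //= len lem.
- by rewrite moves0.
- by rewrite moves0.
congr mex; apply/eq_in_map => mu /sumn_king_moves lt_mu.
by apply: IHn; lia.
Qed.

Lemma grundyE (la : partition) :
  grundy la = mex (map grundy (king_moves la)).
Proof.
rewrite /grundy (@grundy_rec_enough _ (sumn la).+1) //=.
congr mex; apply/eq_in_map => mu /sumn_king_moves lt_mu.
by apply: grundy_rec_enough; lia.
Qed.

Lemma staircaseP (k : nat) : is_partition (rev (iota 1 k)).
Proof.
rewrite /is_partition rev_sorted all_rev iota_sorted /=.
by apply/allP => p; rewrite mem_iota => /andP[].
Qed.

(* [k, k-1, ..., 1] *)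
Definition staircase (k : nat) : partition := Partition (staircaseP k).

(* Main.v *)
Require Import Defs.
From mathcomp Require Import all_boot zify.

(** Removing the first row of a staircase, or its first column, leaves the next
    smaller staircase, and removing both leaves the one after. So the game is a
    subtraction game with subtraction set {1, 2}, whose values have period 3. *)

Lemma mexP (s : seq nat) (m : nat) :
  m \notin s -> (forall n, n < m -> n \in s) -> mex s = m.
Proof.
move=> m_notin lt_in; rewrite /mex; case: ex_minnP => n n_notin n_min.
apply/eqP; rewrite eqn_leq n_min //= leqNgt.
by apply: contra n_notin; apply: lt_in.
Qed.

Lemma staircaseS (k : nat) :
  parts (staircase k.+1) = k.+1 :: parts (staircase k).
Proof.
transitivity (rev (iota 1 (k + 1))); first by rewrite addn1.
by rewrite iotaD rev_cat.
Qed.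

Lemma king_moves_staircase1 : king_moves (staircase 1) = [::].
Proof. by []. Qed.

Local Opaque staircase.

Lemma shift_staircase01 (k : nat) :
  shift (staircase k.+1) 0 1 = staircase k.
Proof.
apply: val_inj; rewrite /= /shift_seq drop0.
(* Only the last part, 1, fails the filter [1 < p]; every other part drops by one. *)
elim: k => [|k IHk]; first by rewrite staircaseS.
by rewrite staircaseS [RHS]staircaseS /= IHk subn1.
Qed.

Lemma shift_staircase10 (k : nat) :
  shift (staircase k.+1) 1 0 = staircase k.
Proof.
apply: val_inj; rewrite /= /shift_seq staircaseS /= drop0.
have /all_filterP-> := partition_gt0 (staircase k).
by rewrite -[RHS]map_id; apply: eq_map => p; rewrite subn0.
Qed.

(** Dropping the first row leaves [staircase k.+1], so this reduces to removing a column from it. *)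
Lemma shift_staircase11 (k : nat) :
  shift (staircase k.+2) 1 1 = staircase k.
Proof.
rewrite -(shift_staircase01 k); apply: val_inj.
by rewrite /= /shift_seq [in LHS]staircaseS.
Qed.

Lemma staircase_neq_nil (k : nat) : parts (staircase k.+1) != [::].
Proof. by rewrite staircaseS. Qed.

(** Treated apart because the move [(1, 1)] would reach the empty partition, which is not a
    position. *)
Lemma king_moves_staircase2 :
  king_moves (staircase 2) = [:: staircase 1; staircase 1].
Proof.
by rewrite /king_moves shift_staircase01 shift_staircase10 shift_staircase11.
Qed.

Lemma king_moves_staircaseSSS (k : nat) :
  king_moves (staircase k.+3) =
    [:: staircase k.+2; staircase k.+2; staircase k.+1].
Proof.
rewrite /king_moves shift_staircase01 shift_staircase10 shift_staircase11.
by rewrite /filter !staircase_neq_nil.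
Qed.

Lemma grundy_staircaseS (k : nat) : grundy (staircase k.+1) = k %% 3.
Proof.
elim/ltn_ind: k => -[|[|k]] IHk; rewrite grundyE.
- by rewrite king_moves_staircase1; apply: mexP.
- rewrite king_moves_staircase2 /= IHk //.
  by apply: mexP => // -[].
rewrite king_moves_staircaseSSS /= !IHk //.
(* The options have values [k.+1 %% 3] and [k %% 3], so the only residue mod 3 they miss is
   [k.+2 %% 3], which is therefore the mex. *)
by apply: mexP => [|n]; rewrite !inE; lia.
Qed.

Theorem lemma3p13 (k : nat) (hk : 0 < k) :
  grundy (staircase k) = (k - 1) %% 3.
Proof. by case: k hk => // k _; rewrite grundy_staircaseS subn1. Qed.
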